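(* Let $P$ be a reduced knot projection. There is a simple closed curve $C\subset S^2$ admissible for $P$ with $C\cap P=\{a,b\}$ for two distinct double points $a,b$ of $P$ that are met in the cyclic order $a,b,a,b$ along $P$ if and only if $y(P)=1$.
   Context: A knot projection is the image of a generic immersion of an unoriented circle into the sphere $S^2$ (the only singularities are transverse double points); every knot projection is assumed to have at least one double point. Traversing $P$ once, each double point is met exactly twice; ''cyclic order along $P$'' refers to the cyclic word obtained this way (up to rotation and reversal), ignoring passages through double points not named. A double point $c$ of $P$ is nugatory if there is a simple closed curve in $S^2$ meeting $P$ only at $c$ and transverse there to both branches of $P$. A knot projection is reducible if it has a nugatory double point, and reduced otherwise. A splice at a double point removes a small neighbourhood of the double point and reconnects the four ends in one of the two planar ways without a crossing. Orient $P$ arbitrarily: the splice compatible with the orientation is the Seifert splice; the other is the non-Seifert splice (applied alone it produces one closed curve). This does not depend on the orientation chosen. The reductivity $y(P)$ is the minimum number of non-Seifert splices, applied simultaneously at distinct double points of $P$ (all non-Seifert with respect to $P$), needed to obtain a reducible knot projection (in particular a single closed curve) from $P$; $y(P)=0$ if $P$ is reducible. A simple closed curve $C\subset S^2$ is called admissible for $P$ if $C$ meets $P$ only at double points of $P$ and at each of these points $C$ is transverse to both branches of $P$ (so that on each side of $C$ there are exactly two of the four edge-ends at that double point). *)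

(* Defs.v *)
From mathcomp Require Import all_boot.

Set Implicit Arguments.
Unset Strict Implicit.
Unset Printing Implicit Defensive.

(* Closed curves with transverse double points on an oriented sphere, up to
   homeomorphism, are encoded by combinatorial maps. The dart (v, i) is the
   i-th of the four edge-ends at the double point v, numbered counterclockwise;
   [edge] sends an edge-end to the other end of the same edge. A loop at v is
   an edge between two distinct darts at v. *)
Record diagram := Diagram {
  crossing : finType;
  edge : crossing * 'I_4 -> crossing * 'I_4
}.

Notation dart D := (crossing D * 'I_4)%type.

Section Diagram.
Variable D : diagram.
Implicit Types (d x : dart D) (S : {set crossing D}) (a b c : crossing D).

Definition node d : dart D := (d.1, ordS d.2).
Definition node_inv d : dart D := (d.1, ord_pred d.2).

(* For an edge-end this is the other end of the same branch; for a corner (see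
   [face]) it is the vertically opposite corner. *)
Definition opp d : dart D := node (node d).

(* Leave along d, arrive along [edge d], go straight across. Each closed curve
   gives two orbits of darts, one per orientation, each consisting of the
   edge-ends along which the oriented curve leaves a double point. *)
Definition straight d : dart D := opp (edge d).

(* The non-Seifert splice pairs the two outgoing ends with each other and the
   two incoming ends with each other; in either case these are the neighbours
   in the rotation that lie in the same orbit of [straight]. Reversing the
   orientation only exchanges the two orbits. *)
Definition nonSeifert d : dart D :=
  if fconnect straight d (node d) then node d else node_inv d.

(* Below, (D, S) stands for the curve in the same sphere obtained from D by
   non-Seifert splices, all taken with respect to D, at the double points in S.
   Its double points are those of D outside S; at the points of S the curve
   passes from x to [nonSeifert x] without crossing. *)
Definition walk S d : dart D :=
  let x := edge d in if x.1 \in S then nonSeifert x else opp x.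

(* All darts of D are followed, so circles without double points created by
   the splices are not overlooked. *)
Definition single_curve S : Prop :=
  forall d x, fconnect (walk S) d x \/ fconnect (walk S) d (edge x).

(* For v outside S the dart d = (v, i) also denotes the corner at v between d
   and [node d], i.e. the one to the left when leaving along d. The map [face]
   goes along the boundary of the region to the left of d: it turns left at the
   double points and follows the curve at the splices. When (D, S) is connected
   its complementary regions are open discs, and the orbits of [face] are their
   boundary walks, in cyclic order. *)
Definition face S d : dart D :=
  let x := edge d in if x.1 \in S then nonSeifert x else node_inv x.

(* The chord from x to x' does not cross the chord from y to y' in a disc with
   boundary walk an orbit of f; no condition for chords in different discs. *)
Definition unlinked (f : dart D -> dart D) (x x' y y' : dart D) : Prop :=
  fconnect f x y ->
  (findex f x y < findex f x x') = (findex f x y' < findex f x x').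

(* A simple closed curve meeting (D, S) only in double points, transversally to
   both branches, is recorded by the cyclic sequence of the corners through
   which it leaves the successive double points; by transversality it enters
   each of them through the opposite corner. In between it is an arc inside one
   region, and arcs inside a common region are disjoint. *)
Definition admissible S (C : seq (dart D)) : Prop :=
  [/\ C != [::],
      uniq [seq x.1 | x <- C],
      {in C, forall x, x.1 \notin S},
      cycle (fun x y => fconnect (face S) x (opp y)) C &
      {in C &, forall x y, x != y ->
         unlinked (face S) x (opp (next C x)) y (opp (next C y))}].

Definition meets (C : seq (dart D)) : {set crossing D} := [set x.1 | x in C].

Definition nugatory S c : Prop :=
  exists C : seq (dart D), admissible S C /\ meets C = [set c].

Definition reducible S : Prop := single_curve S /\ exists c, nugatory S c.

(* The freedom of choosing d accounts for rotation and reversal. *)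
Definition interleaved a b : Prop :=
  exists d, [seq c <- [seq x.1 | x <- orbit straight d] | c \in [:: a; b]]
            = [:: a; b; a; b].

End Diagram.

(* The sphere is encoded by Euler's formula V + F = E + 2; connectedness
   follows from [kp_single]. *)
Record knot_projection := KnotProjection {
  kp_diagram :> diagram;
  kp_edgeK : involutive (@edge kp_diagram);
  kp_edge_neq : forall d : dart kp_diagram, edge d != d;
  kp_nonempty : 0 < #|crossing kp_diagram|;
  kp_single : single_curve (set0 : {set crossing kp_diagram});
  kp_planar : #|crossing kp_diagram| + fcard (face (set0 : {set crossing kp_diagram})) predT
              = fcard (@edge kp_diagram) predT + 2
}.

Definition reduced (P : knot_projection) : Prop :=
  ~ reducible (set0 : {set crossing P}).

(* y(P) = k *)
Definition reductivity (P : knot_projection) (k : nat) : Prop :=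
  (exists S : {set crossing P}, reducible S /\ #|S| = k) /\
  (forall S : {set crossing P}, reducible S -> k <= #|S|).

(* Main.v *)
From mathcomp Require Import all_boot perm ssralg zmodp matrix mxalgebra.
Require Import Defs.

(** Write P for the projection, and cut the sphere along a closed curve C that
    passes through exactly two double points a and b. Three facts combine.

    Jordan curve theorem. The curve P changes side of C exactly when it runs
    through a or b. Hence, on a traversal of P, consecutive visits to {a, b}
    leave into alternating sides, and the cyclic order is a, b, a, b exactly
    when the two outgoing ends at a lie on the same side of C, that is, when C
    passes between the pairs of ends that the non-Seifert splice at a joins
    ([jordan_side], [interleavedP]). The Jordan theorem is obtained from Euler's
    formula: it forces the cellular cochain complex of the sphere over F_2 to be
    exact in degree 1, by counting ranks, so that the mod 2 intersection number
    of the edges with C is the coboundary of a function on the double points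
    ([cocycle_coboundary]).

    Splicing. A non-Seifert splice keeps a single curve, because it only
    reverses one of the two loops at the double point ([single_curve1]). On
    regions its effect is to multiply the face permutation by the transposition
    of the two opposite corners that become connected ([face1]). Since P is
    reduced these corners lie in distinct regions, which are therefore merged,
    and nothing else changes ([fconnect_swap], [swap_merges], [swap_coarser]).

    Comparison. After the splice at a, a double point b is nugatory exactly when
    its two opposite corners have been brought into a common region, and as they
    were not in one before, the merged region is where they meet: one corner of
    b shares a region of P with one of the merged corners of a, the other corner
    with the other one ([nugatory_after_splice]). This is a closed curve through
    a and b that separates the two pairs of ends joined by the splice at a. Its
    two arcs are disjoint because they lie in distinct regions: in a common
    region they would bring together opposite corners at a
    ([two_point_curveP]). *)

Set Implicit Arguments.
Unset Strict Implicit.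
Unset Printing Implicit Defensive.

(** * The four ends at a double point *)

Section Rotation.
Variable D : diagram.
Implicit Types (d x : dart D) (S : {set crossing D}).

Lemma nodeK : cancel (@node D) (@node_inv D).
Proof. by case=> v i; rewrite /node /node_inv /= ordSK. Qed.

Lemma node_invK : cancel (@node_inv D) (@node D).
Proof. by case=> v i; rewrite /node /node_inv /= ord_predK. Qed.

Lemma oppK : involutive (@opp D).
Proof.
by case=> v [[|[|[|[|//]]]] lti]; congr pair; apply: val_inj.
Qed.

Lemma node_invE d : node_inv d = opp (node d).
Proof. by apply: (canLR nodeK); rewrite -[RHS]/(opp (opp d)) oppK. Qed.

Lemma opp_neq d : opp d != d.
Proof. by case: d => v [[|[|[|[|//]]]] lti]; rewrite xpair_eqE eqxx. Qed.

Lemma node_neq d : node d != d.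
Proof. by case: d => v [[|[|[|[|//]]]] lti]; rewrite xpair_eqE eqxx. Qed.

Lemma node_neq_opp d : node d != opp d.
Proof. by case: d => v [[|[|[|[|//]]]] lti]; rewrite xpair_eqE eqxx. Qed.

Lemma same_crossing d x :
  d.1 = x.1 -> [|| d == x, d == node x, d == opp x | d == opp (node x)].
Proof.
case: d x => v i [w j] /= <-; rewrite !xpair_eqE !eqxx /= -!val_eqE /=.
by case: i j => [[|[|[|[|//]]]] ?] [[|[|[|[|//]]]] ?].
Qed.

End Rotation.

(** * Orientations of the curve *)

Section Orientation.
Variable P : knot_projection.
Implicit Types (d x z : dart P).

Lemma edgeK : involutive (@edge P).
Proof. exact: kp_edgeK. Qed.

Lemma straightK d : straight (edge d) = opp d.
Proof. by rewrite /straight edgeK. Qed.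

Lemma straight_inj : injective (@straight P).
Proof. exact: inj_comp (can_inj (@oppK P)) (can_inj edgeK). Qed.

Lemma edge_straight d : straight (edge (straight d)) = edge d.
Proof. by rewrite straightK oppK. Qed.

Lemma iter_edge_straight n d :
  iter n (@straight P) (edge (iter n (@straight P) d)) = edge d.
Proof. by elim: n d => //= n IHn d; rewrite -iterS iterSr edge_straight IHn. Qed.

(** If the curve traversed some edge in both directions, then halfway between
    the two passages it would have to reverse, either inside an edge or at a
    double point; neither [edge] nor [opp] has a fixed point. *)
Lemma straight_one_way d : ~~ fconnect (@straight P) d (edge d).
Proof.
apply/negP => /iter_findex; set k := findex _ _ _.
(* u is the halfway point *)
rewrite -(odd_double_half k) -addnn addnA iterD.
set u := iter k./2 _ d => def_ed.
have {}def_ed: iter (odd k) (@straight P) u = edge u.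
  apply: (can_inj edgeK); rewrite edgeK.
  have inj_iter: injective (iter k./2 (@straight P)).
    by elim: (k./2) => //= n IHn x1 x2 /straight_inj/IHn.
  apply: (can_inj edgeK); apply: inj_iter.
  by rewrite edgeK iter_edge_straight -iterD addnC.
case: (odd k) def_ed => /= def_eu.
  by have := opp_neq (edge u); rewrite -[opp _]/(straight u) def_eu eqxx.
by have := kp_edge_neq u; rewrite -def_eu eqxx.
Qed.

Lemma walk0 : walk (set0 : {set crossing P}) =1 @straight P.
Proof. by move=> d; rewrite /walk inE. Qed.

Lemma face0 d : face (set0 : {set crossing P}) d = node_inv (edge d).
Proof. by rewrite /face inE. Qed.

(** With a single curve there are exactly two orbits of [straight], the two
    orientations, exchanged by [edge] and hence also by [opp]. Membership in the
    orbit of a fixed dart is used below as the orientation of the curve. *)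
Lemma same_straight_edge d x :
  fconnect (@straight P) d (edge x) = ~~ fconnect (@straight P) d x.
Proof.
apply/idP/idP => [dex | ].
  apply: contra (straight_one_way x) => dx.
  by rewrite (connect_trans _ dex) // fconnect_sym //; apply: straight_inj.
by have [] := @kp_single P d x; rewrite !(eq_fconnect walk0) => ->.
Qed.

Lemma same_straight_opp d x :
  fconnect (@straight P) d (opp x) = ~~ fconnect (@straight P) d x.
Proof.
by rewrite -straightK -same_fconnect1_r ?same_straight_edge //; apply: straight_inj.
Qed.

End Orientation.

(** * Exactness of the cochain complex of the sphere over F_2 *)

Section Exactness.
Local Open Scope ring_scope.
Import GRing.Theory.

Lemma exact_of_rank (F : fieldType) m n p (A : 'M[F]_(m, n)) (B : 'M_(n, p)) :
    A *m B = 0 -> (n <= \rank A + \rank B)%N ->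
  forall v : 'rV_n, v *m B = 0 -> exists u, v = u *m A.
Proof.
move=> /sub_kermxP sAB rankAB v /sub_kermxP vB; apply/submxP.
rewrite (submx_trans vB) // -(mxrank_leqif_sup sAB).2 eqn_leq mxrankS //=.
by rewrite mxrank_ker leq_subLR addnC.
Qed.

(** Used for both coboundary maps: the kernel consists of constants when the
    curve is connected, so the rank falls short by at most one. *)
Lemma rank_ge_pred (F : fieldType) m n (A : 'M[F]_(m, n)) :
    (forall u : 'rV_m, u *m A = 0 -> forall i j, u 0 i = u 0 j) ->
  (m.-1 <= \rank A)%N.
Proof.
case: m A => // m A constA; rewrite -subn1 leq_subCl -mxrank_ker.
apply: leq_trans (rank_leq_row (const_mx 1 : 'rV[F]_m.+1)).
apply/mxrankS/row_subP => i; set u := row i _.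
have /constA constu: u *m A = 0 by rewrite -row_mul mulmx_ker row0.
apply/submxP; exists (u 0 0)%:M; apply/rowP => j.
by rewrite mul_scalar_mx [RHS]mxE [const_mx _ _ _]mxE mulr1 (constu 0 j).
Qed.

Lemma sum_delta (R : pzSemiRingType) (T : finType) (g : T -> R) c :
  \sum_i g i * (i == c)%:R = g c.
Proof.
rewrite (bigD1 c) //= eqxx mulr1 big1 ?addr0 // => i /negPf->.
by rewrite mulr0.
Qed.

Section Planar.
Variable P : knot_projection.
Implicit Types (d x z : dart P).

Local Notation region := (face (set0 : {set crossing P})).
Local Notation O d0 := [pred d | fconnect (@straight P) d0 d].

Lemma region_inj : injective region.
Proof.
by move=> d x; rewrite !face0 => /(can_inj (@node_invK P))/(can_inj (@edgeK P)).
Qed.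

Lemma region_edge d : region (edge d) = node_inv d.
Proof. by rewrite face0 edgeK. Qed.

(** The form in which the connectedness of the curve is used. *)
Lemma straight_connected (T : eqType) (h : dart P -> T) :
    (forall d, h (edge d) = h d) -> (forall d, h (straight d) = h d) ->
  forall d x, h d = h x.
Proof.
move=> h_edge h_str d x; have inv: invariant (@straight P) h =1 xpredT.
  by move=> z; rewrite /= h_str eqxx.
have [] := @kp_single P d x; rewrite (eq_fconnect (@walk0 P)).
  exact: fconnect_invariant.
by move/(fconnect_invariant inv)->; rewrite h_edge.
Qed.

(** An orientation selects one of the two darts of each edge, so that the darts
    in one orbit of [straight] serve as an index set for the edges. *)
Lemma sum_oriented (d0 : dart P) (h : dart P -> 'F_2) :
  \sum_(k < #|O d0|) (h (enum_val k) + h (edge (enum_val k))) = \sum_d h d.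
Proof.
rewrite big_split /= -(big_enum_val (A := O d0) h).
rewrite -(big_enum_val (A := O d0) (h \o @edge P)) /=.
rewrite [RHS](bigID (O d0)) /=; congr (_ + _).
rewrite (reindex_inj (can_inj (@edgeK P))) /=.
by apply: eq_big => [d | d _]; rewrite ?inE ?same_straight_edge ?edgeK.
Qed.

Lemma card_oriented (d0 : dart P) : #|O d0| = fcard (@edge P) predT.
Proof.
apply: double_inj; rewrite -addnn -muln2 (fcard_order_set (can_inj (@edgeK P))) //.
  rewrite -[RHS](cardC (O d0)); congr (_ + _)%N.
  rewrite -(card_image (can_inj (@edgeK P))); apply: eq_card => d.
  rewrite -[d in LHS]edgeK mem_image; last exact: can_inj (@edgeK P).
  by rewrite !inE same_straight_edge.
apply/subsetP => d _; rewrite inE (order_cycle (p := [:: d; edge d])) ?inE ?eqxx //.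
  by rewrite /= edgeK !eqxx.
by rewrite /= inE eq_sym kp_edge_neq.
Qed.

Lemma addFF (x : 'F_2) : x + x = 0.
Proof. by case: x => [[|[|//]]] ?; apply: val_inj. Qed.

Lemma addF_eq0 (x y : 'F_2) : (x + y == 0) = (x == y).
Proof. by case: x y => [[|[|//]] ?] [[|[|//]] ?]. Qed.

(** The vanishing of the first cohomology group of the sphere, with coefficients
    in F_2. The vertex-edge matrix A and the edge-region matrix B have ranks at
    least V - 1 and F - 1 because the kernels of A and of the transpose of B
    consist of constants. As V + F = E + 2, these ranks add up to at least E,
    which leaves no room between the image of A and the kernel of B. *)
Lemma cocycle_coboundary (w : dart P -> 'F_2) :
    (forall d, w (edge d) = w d) ->
    (forall z, \sum_(d | fconnect region z d) w d = 0) ->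
  exists s : crossing P -> 'F_2, forall d, w d = s d.1 + s (edge d).1.
Proof.
move=> w_edge w_closed; have /card_gt0P[v0 _] := kp_nonempty P.
set d0 : dart P := (v0, ord0).
have symf := fconnect_sym region_inj.
pose vtx d : 'I_#|crossing P| := enum_rank d.1.
have reg_root d : froot region d \in froots region by exact: roots_root.
pose reg d : 'I_#|froots region| := enum_rank_in (reg_root d) (froot region d).
pose A : 'M['F_2]_(#|crossing P|, #|O d0|) :=
  \matrix_(i, k) ((i == vtx (enum_val k))%:R + (i == vtx (edge (enum_val k)))%:R).
pose B : 'M['F_2]_(#|O d0|, #|froots region|) :=
  \matrix_(k, j) ((j == reg (enum_val k))%:R + (j == reg (edge (enum_val k)))%:R).
have eq_reg z d : (reg z == reg d) = fconnect region z d.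
  rewrite -(inj_eq enum_val_inj) !enum_rankK_in ?reg_root //.
  exact: root_connect.
have reg_region d : reg (region d) = reg d.
  by apply/eqP; rewrite eq_reg symf fconnect1.
have reg_node d : reg (edge d) = reg (node_inv d).
  by rewrite -region_edge reg_region.
have mulA (u : 'rV_#|crossing P|) k :
    (u *m A) 0 k = u 0 (vtx (enum_val k)) + u 0 (vtx (edge (enum_val k))).
  rewrite mxE; under eq_bigr => i _ do rewrite mxE mulrDr.
  by rewrite big_split /= !sum_delta.
have mulB (u : 'rV_#|froots region|) k :
    (u *m B^T) 0 k = u 0 (reg (enum_val k)) + u 0 (reg (edge (enum_val k))).
  rewrite mxE; under eq_bigr => i _ do rewrite !mxE mulrDr.
  by rewrite big_split /= !sum_delta.
have on_darts (T : eqType) (h : dart P -> T) :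
    (forall k : 'I_#|O d0|, h (enum_val k) = h (edge (enum_val k))) ->
  forall d, h (edge d) = h d.
  move=> h_edge d; case Od: (d \in O d0).
    by rewrite -(enum_rankK_in Od Od) h_edge.
  have Oed: edge d \in O d0 by rewrite inE same_straight_edge; apply/negbT.
  by rewrite -{2}[d]edgeK -(enum_rankK_in Oed Oed) h_edge.
have AB0: A *m B = 0.
  (* Around a double point each corner is counted twice, once for each of the
     two ends that bound it. *)
  apply/matrixP => i j; rewrite !mxE.
  pose h d := (i == vtx d)%:R * ((j == reg d)%:R + (j == reg (edge d))%:R) : 'F_2.
  transitivity (\sum_(k < #|O d0|) (h (enum_val k) + h (edge (enum_val k)))).
    apply: eq_bigr => k _; rewrite !mxE /h edgeK mulrDl; congr (_ + _).
    by rewrite addrC.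
  rewrite sum_oriented /h.
  under eq_bigr => d _ do rewrite reg_node mulrDr.
  rewrite big_split /=; set X := \sum_d _.
  have ->: \sum_d (i == vtx d)%:R * (j == reg (node_inv d))%:R = X.
    rewrite (reindex_inj (can_inj (@nodeK P))).
    by apply: eq_bigr => d _; rewrite nodeK.
  exact: addFF.
have rankA: (#|crossing P|.-1 <= \rank A)%N.
  apply: rank_ge_pred => u uA i j.
  have u_edge: forall d, u 0 (vtx (edge d)) = u 0 (vtx d).
    apply: (on_darts _ (fun d => u 0 (vtx d))) => k.
    by apply/eqP; rewrite -addF_eq0 -mulA uA mxE.
  have:= straight_connected u_edge u_edge (enum_val i, ord0) (enum_val j, ord0).
  by rewrite /vtx /= !enum_valK.
have rankB: (#|froots region|.-1 <= \rank B)%N.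
  rewrite -mxrank_tr; apply: rank_ge_pred => u uB i j.
  have u_edge: forall d, u 0 (reg (edge d)) = u 0 (reg d).
    apply: (on_darts _ (fun d => u 0 (reg d))) => k.
    by apply/eqP; rewrite -addF_eq0 -mulB uB mxE.
  have u_node d : u 0 (reg (node d)) = u 0 (reg d).
    by rewrite -u_edge reg_node nodeK.
  have regK k : reg (enum_val k) = k.
    apply: enum_val_inj; rewrite enum_rankK_in ?reg_root //.
    exact/eqP/(enum_valP k).
  rewrite -[i]regK -[j]regK; apply: (straight_connected u_edge) => d.
  by rewrite /straight /opp !u_node.
have rankAB: (#|O d0| <= \rank A + \rank B)%N.
  have def_F: fcard region predT = #|froots region|.
    by apply: eq_card => d; apply: andbT.
  have := kp_planar P; rewrite def_F -(card_oriented d0).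
  move: (\rank A) (\rank B) rankA rankB => rA rB rankA rankB VFE.
  rewrite -(leq_add2r 2) -VFE (addnACA rA rB 1 1)%N !addn1.
  by rewrite leq_add // (leq_trans (leqSpred _)).
pose v : 'rV['F_2]_#|O d0| := \row_k w (enum_val k).
have vB: v *m B = 0.
  apply/rowP => j; rewrite !mxE.
  pose h d := w d * (j == reg d)%:R.
  transitivity (\sum_(k < #|O d0|) (h (enum_val k) + h (edge (enum_val k)))).
    by apply: eq_bigr => k _; rewrite !mxE /h w_edge mulrDr.
  rewrite sum_oriented -[RHS](w_closed (enum_val j)) [RHS]big_mkcond /=.
  apply: eq_bigr => d _.
  have ->: fconnect region (enum_val j) d = (j == reg d).
    rewrite -eq_reg; congr (_ == _).
    apply: enum_val_inj; rewrite enum_rankK_in ?reg_root //.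
    exact/eqP/(enum_valP j).
  by rewrite /h; case: eqP; rewrite ?mulr1 ?mulr0.
have [u def_v] := exact_of_rank AB0 rankAB vB.
exists (fun c => u 0 (enum_rank c)) => d.
have def_w (k : 'I_#|O d0|) :
    w (enum_val k) = u 0 (vtx (enum_val k)) + u 0 (vtx (edge (enum_val k))).
  by rewrite -mulA -def_v mxE.
case Od: (d \in O d0); first by rewrite -(enum_rankK_in Od Od) def_w.
have Oed: edge d \in O d0 by rewrite inE same_straight_edge; apply/negbT.
by rewrite -w_edge -{2}[d]edgeK addrC -(enum_rankK_in Oed Oed) def_w.
Qed.

End Planar.
End Exactness.

(** * Sides of a closed curve through two double points *)

Section Sides.
Variable D : diagram.
Implicit Types (d x : dart D).

(** A closed curve that enters a double point through the corner [opp x] and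
    leaves through the corner x has these two ends on its left. *)
Definition left_end x d : bool := (d == node x) (+) (d == opp x).

Lemma left_end_opp x d : left_end x (opp d) = left_end x d (+) (d.1 == x.1).
Proof.
case: x d => v i [w j]; rewrite /left_end !xpair_eqE /= -!val_eqE.
case: eqP => // _.
by case: i j => [[|[|[|[|//]]]] ?] [[|[|[|[|//]]]] ?].
Qed.

Lemma left_endxx x : left_end x x = false.
Proof.
by rewrite /left_end ![x == _]eq_sym (negPf (opp_neq x)) (negPf (node_neq x)).
Qed.

Lemma left_end_far x d : d.1 != x.1 -> left_end x d = false.
Proof. by case: x d => v i [w j]; rewrite /left_end !xpair_eqE /= => /negPf->. Qed.

End Sides.

Section Jordan.
Import GRing.Theory.
Variable P : knot_projection.
Implicit Types (d x y z : dart P).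
Local Notation region := (face (set0 : {set crossing P})).

Lemma natr_addb (a b : bool) : ((a (+) b)%:R = a%:R + b%:R :> 'F_2)%R.
Proof. by case: a b => [] []; rewrite ?addr0 ?add0r ?addFF. Qed.

(** Push the curve off both double points to its left: it then crosses the edges
    of the four left ends and enters and leaves each region equally often, so
    that these crossings form a cocycle. A primitive s of it tells on which side
    of the pushed curve each double point lies; adding [left_end] corrects this
    to the side of the original curve for every edge-end. *)
Lemma jordan_side x y :
    fconnect region x (opp y) -> fconnect region y (opp x) -> x.1 != y.1 ->
  exists side : dart P -> bool,
    (forall d, side (straight d)
               = side d (+) ((straight d).1 \in [:: x.1; y.1])) /\
    (forall d, d.1 = x.1 -> side d = side x (+) left_end x d).
Proof.
move=> xy yx neq_xy.
pose t d := left_end x d (+) left_end y d.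
pose w d : 'F_2 := ((t d)%:R + (t (edge d))%:R)%R.
have [d | z | s def_s] := @cocycle_coboundary P w.
- by rewrite /w edgeK addrC.
- rewrite /w big_split /=.
  have sum_eq c : (\sum_(d | fconnect region z d) (d == c)%:R
                   = (fconnect region z c)%:R :> 'F_2)%R.
    rewrite big_mkcond (bigD1 c) //= eqxx big1 => [|d /negPf->]; last by case: ifP.
    by rewrite addr0; case: ifP.
  have ->: (\sum_(d | fconnect region z d) (t (edge d))%:R
            = \sum_(d | fconnect region z d) (t (node d))%:R :> 'F_2)%R.
    rewrite [RHS](reindex_inj (@region_inj P)); apply: eq_big => d.
      exact/same_fconnect1_r/region_inj.
    by rewrite face0 node_invK.
  have tE d : ((t d)%:R = (d == node x)%:R + (d == opp x)%:R
                          + ((d == node y)%:R + (d == opp y)%:R) :> 'F_2)%R.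
    by rewrite !natr_addb.
  under eq_bigr do rewrite tE.
  under [X in (_ + X)%R]eq_bigr do
    rewrite tE /opp !(inj_eq (can_inj (@nodeK P))).
  rewrite !big_split /= !sum_eq.
  have symf := fconnect_sym (@region_inj P).
  (* The corners between two left ends are counted twice. The remaining ones,
     x, [opp x], y and [opp y], are matched in pairs by the two arcs. *)
  have ->: fconnect region z (opp x) = fconnect region z y.
    by rewrite ![_ z _]symf; apply/esym/(same_connect symf).
  have ->: fconnect region z (opp y) = fconnect region z x.
    by rewrite ![_ z _]symf; apply/esym/(same_connect symf).
  move: (_ z (node x)) (_ z (node y)) (_ z x) (_ z y).
  by do 4!case; apply: val_inj.
pose side d := (s d.1 + (t d)%:R != 0)%R.
have t_opp d : t (opp d) = t d (+) (d.1 \in [:: x.1; y.1]).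
  rewrite /t !left_end_opp !inE; case: eqP => [->|_].
    by rewrite (negPf neq_xy); case: (left_end x d) (left_end y d) => [] [].
  by case: (_ == _) (left_end x d) (left_end y d) => [] [] [].
have side_edge d : side (edge d) = side d.
  congr (_ != _); apply/eqP; rewrite -addF_eq0 addrACA.
  by rewrite [(s _ + _)%R]addrC -def_s -[(_%:R + _)%R]addrC addFF.
exists side; split=> [d | d def_d].
  rewrite -(side_edge d) {1}/straight /side t_opp natr_addb addrA.
  rewrite -[(opp (edge d)).1]/(edge d).1.
  move: (_ + _)%R (_ \in _) => u [] /=.
    by case: u => [[|[|//]]].
  by rewrite addr0 addbF.
have far z : z.1 = x.1 -> t z = left_end x z.
  by move=> def_z; rewrite /t [left_end y z]left_end_far ?addbF // def_z.
rewrite /side !far // left_endxx def_d addr0.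
by move: (s _) (left_end _ _) => [[|[|//]] ?] [].
Qed.

End Jordan.

(** * Interleaving and orientations *)

Section Interleaving.
Variable P : knot_projection.
Implicit Types (d x y z : dart P).
Local Notation co := (fconnect (@straight P)).

Lemma straight_sym x y : co x y = co y x.
Proof. exact/fconnect_sym/straight_inj. Qed.

Lemma marks_alternate (T : eqType) (f : T -> T) (side : T -> bool) (p : pred T) :
    (forall u, side (f u) = side u (+) p (f u)) ->
  forall u l, fpath f u l ->
    path (fun b b' => b' != b) (side u) [seq side v | v <- l & p v].
Proof.
move=> side_f u l; elim: l u => //= _ l IHl u /andP[/eqP<- fl].
have := IHl _ fl; rewrite side_f; case: ifP => p_fu /=; rewrite ?addbF //.
by rewrite side_f p_fu addbT => ->; case: (side u).
Qed.

(** Of two opposite ends exactly one is outgoing for a given orientation. *)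
Lemma outgoing_ends z y : exists y1 y2,
  [/\ y1.1 = y.1, y2.1 = y.1, y1 != y2
    & forall u, u.1 = y.1 -> co z u = (u == y1) || (u == y2)].
Proof.
have /and4P[] : uniq [:: y; node y; opp y; opp (node y)].
  by case: y => v [[|[|[|[|//]]]] ?]; rewrite /= !inE !xpair_eqE !eqxx.
rewrite !inE => /norP[n1 /norP[n2 n3]] /norP[n4 n5] n6 _.
exists (if co z y then y else opp y).
exists (if co z (node y) then node y else opp (node y)).
split=> [|||u]; first by case: ifP.
- by case: ifP.
- by case: ifP; case: ifP; rewrite // eq_sym.
case/same_crossing/or4P => /eqP->; rewrite ?same_straight_opp;
  case: (co z y) (co z (node y)) => [] [];
  rewrite ?eqxx ?orbT //; apply/esym/norP; split;
  by rewrite // eq_sym.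
Qed.

(** The visits to the two double points leave into alternating sides. If the
    order is a, b, a, b then both departures from a = x.1 are into the same side.
    Conversely, if the two outgoing ends at a are on the same side, they cannot
    be consecutive among the four visits. *)
Lemma interleavedP side x y :
    x.1 != y.1 ->
    (forall d, side (straight d)
               = side d (+) ((straight d).1 \in [:: x.1; y.1])) ->
    (forall d, d.1 = x.1 -> side d = side x (+) left_end x d) ->
  interleaved x.1 y.1 <-> co (node x) (opp x).
Proof.
move=> neq_xy side_str side_x.
pose l d := [seq z <- fingraph.orbit (@straight P) d | z.1 \in [:: x.1; y.1]].
have l_uniq d : uniq (l d) by rewrite filter_uniq ?orbit_uniq.
have in_l d z : z \in l d = (z.1 \in [:: x.1; y.1]) && co d z.
  by rewrite mem_filter fconnect_orbit.
have l_alt d : exists b, path (fun b b' => b' != b) b (map side (l d)).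
  (* The path starts at the dart preceding d, so that d itself is included. *)
  exists (side (edge (opp d))).
  apply: (marks_alternate (p := fun z => z.1 \in [:: x.1; y.1])) side_str _ _ _.
  have := fpath_traject (@straight P) (edge (opp d))
                        (fingraph.order (@straight P) d).
  by rewrite straightK oppK.
have neq_n := node_neq_opp x.
have opp_left: left_end x (opp x) by rewrite left_end_opp eqxx left_endxx.
have node_left: left_end x (node x) by rewrite /left_end eqxx (negPf neq_n).
split=> [[d] | xx].
  rewrite filter_map -/(l d) => def_l.
  have := l_uniq d; have [b] := l_alt d; have := in_l d; move: def_l.
  case: (l d) => [|d1 [|d2 [|d3 [|d4 [|]]]]] //= [d1x _ d3x _] in_ld.
  rewrite !inE => /and5P[_ d21 d32 _ _] /and4P[/norP[_ /norP[neq13 _]] _ _ _].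
  have co13: co d1 d3.
    have := in_ld d1; have := in_ld d3; rewrite !inE !eqxx !orbT /=.
    move=> /esym/andP[_ co3] /esym/andP[_ co1].
    by rewrite straight_sym in co1; apply: connect_trans co3.
  have: left_end x d1 = left_end x d3.
    apply: (@addbI (side x)); rewrite -(side_x d1) // -(side_x d3) //.
    by case: (side d1) (side d2) (side d3) d21 d32 => [] [] [].
  have node_opp_left: left_end x (opp (node x)) = false.
    by rewrite left_end_opp eqxx /left_end eqxx (negPf neq_n).
  case/or4P: (same_crossing d1x) co13 neq13 => /eqP->;
    case/or4P: (same_crossing d3x) => /eqP->;
    rewrite ?eqxx ?left_endxx ?node_opp_left ?opp_left ?node_left //= => xx _ _.
  - by rewrite same_straight_opp straight_sym -same_straight_opp.
  - by rewrite straight_sym.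
  by rewrite same_straight_opp straight_sym -same_straight_opp straight_sym.
exists (node x); rewrite filter_map -/(l _).
have [y1 [y2 [def_y1 def_y2 neq12 co_y]]] := outgoing_ends (node x) y.
have [x1 [x2 [def_x1 def_x2 neq_x12 co_x]]] := outgoing_ends (node x) x.
have far z z' : z.1 = x.1 -> z'.1 = y.1 -> (z == z') = false.
  move=> def_z def_z'; apply: contraNF neq_xy => /eqP eqz.
  by rewrite -def_z eqz def_z'.
have in_l4 z : z \in l (node x) = (z \in [:: x1; x2; y1; y2]).
  rewrite in_l !inE; case: eqP => [def_z | neq_z] /=.
    by rewrite co_x // (far z y1) // (far z y2) // !orbF.
  case: eqP => [def_z | neq_z'] /=.
    by rewrite co_y // ![z == _]eq_sym (far x1) // (far x2).
  apply/esym; apply/negP => /or4P[] /eqP def_z;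
    by rewrite def_z ?(def_x1, def_x2, def_y1, def_y2) in neq_z neq_z'.
have l4_uniq: uniq [:: x1; x2; y1; y2].
  rewrite /= !inE (far x1 y1) ?(far x1 y2) ?(far x2 y1) ?(far x2 y2) //.
  by rewrite (negPf neq_x12) neq12.
have l_size := perm_size (uniq_perm (l_uniq (node x)) l4_uniq in_l4).
have in_ox: opp x \in l (node x) by rewrite in_l inE eqxx.
have := l_uniq (node x); have [b] := l_alt (node x).
have [l' def_l]: exists l', l (node x) = node x :: l'.
  by rewrite /l /fingraph.orbit -orderSpred /= !inE eqxx /=; eexists.
have at_y z : z \in l (node x) -> z != node x -> z != opp x -> z.1 = y.1.
  rewrite in_l !inE => /andP[/orP[] /eqP // def_z].
  case/or4P: (same_crossing def_z) => /eqP->; rewrite ?eqxx //.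
    by rewrite -[x in co _ x]oppK same_straight_opp xx.
  by rewrite same_straight_opp connect0.
move: at_y in_ox l_size; rewrite {}def_l => at_y in_ox.
case: l' at_y in_ox => [|p [|q [|r [|]]]] //= at_y in_ox _.
have side_ox: side (opp x) = side (node x).
  by rewrite (side_x (opp x)) // (side_x (node x)) // opp_left node_left.
case/and5P=> _ pn qp rq _ /and4P[].
rewrite !inE !negb_or => /and3P[np nq nr] /andP[npq npr] nqr _.
have neq_p: p != opp x by apply: contraNneq pn => ->; rewrite side_ox.
have def_q: q = opp x.
  move: in_ox; rewrite !inE [opp x == node x]eq_sym (negPf neq_n) /=.
  rewrite [opp x == p]eq_sym (negPf neq_p) /= => /orP[] /eqP // def_r; exfalso.
  move: pn qp rq; rewrite -def_r side_ox.
  by case: (side (node x)) (side p) (side q) => [] [] [].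
rewrite def_q (at_y p) ?(at_y r) ?inE ?eqxx ?orbT //; try by rewrite eq_sym.
by rewrite -def_q eq_sym.
Qed.
End Interleaving.

(** * Composition of a permutation with a transposition *)

Section Swap.
Variables (T : finType) (f g : T -> T) (p q : T).
Hypotheses (f_inj : injective f) (gE : forall u, g u = tperm p q (f u)).

Lemma swap_inj : injective g.
Proof. by move=> u v; rewrite !gE => /perm_inj/f_inj. Qed.

Lemma swap_cases u :
  (f u \in [:: p; q]) && (g u \in [:: p; q]) || (g u == f u).
Proof. by rewrite gE !inE; case: tpermP => [->|->|_ _]; rewrite !eqxx ?orbT. Qed.

Lemma fconnect_swap u v :
    fconnect g u v ->
  fconnect f u v \/ (fconnect f u p \/ fconnect f u q)
                    /\ (fconnect f v p \/ fconnect f v q).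
Proof.
have sym := fconnect_sym f_inj.
move/iter_findex <-; elim: (findex _ _ _) => [|n IHn] /=; first by left.
move: (iter n g u) IHn => {}v IHn.
have f_v: fconnect f (f v) v by rewrite sym fconnect1.
have fv_ z : fconnect f v z = fconnect f (f v) z by apply/esym/(same_connect sym).
have [/andP[fv gv] | /eqP ->] := orP (swap_cases v).
  have fu: fconnect f u p \/ fconnect f u q.
    case: IHn => [uv | [] //].
    have ufv: fconnect f u (f v) := connect_trans uv (fconnect1 f v).
    by move: fv; rewrite !inE => /orP[]/eqP<-; [left | right].
  right; split=> //; move: gv; rewrite !inE => /orP[]/eqP->; [left | right];
    exact: connect0.
case: IHn => [uv | [fu fv]]; first by left; apply: connect_trans (fconnect1 f v).
by right; split=> //; rewrite -!fv_.
Qed.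

(** Follow f from p. Until its orbit closes up it stays away from q, so that g
    agrees with f; the last step, to p for f, leads to q for g. *)
Lemma swap_merges : ~~ fconnect f p q -> fconnect g p q.
Proof.
move=> npq; have before u : fconnect f p u -> fconnect g p u \/ fconnect g p q.
  move/iter_findex <-; elim: (findex _ _ _) => [|n IHn] /=; first by left.
  set v := iter n f p in IHn *.
  case: IHn => [pv|]; last by right.
  have gpv: fconnect g p (g v) := connect_trans pv (fconnect1 g v).
  move: gpv; rewrite gE; case: tpermP => [_ | def_q | _ _]; [by right | | by left].
  by case/negP: npq; rewrite -def_q; apply: (@fconnect_iter _ f n.+1).
case: (before (finv f p)) => //; first exact: fconnect_finv.
move=> pv; apply: connect_trans pv _; apply: connect_trans (fconnect1 g _) _.
by rewrite gE f_finv // tpermL.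
Qed.

Lemma swap_coarser u v : fconnect g p q -> fconnect f u v -> fconnect g u v.
Proof.
move=> pq; have sym := fconnect_sym swap_inj.
move/iter_findex <-; elim: (findex _ _ _) => //= n IHn.
apply: connect_trans IHn _; move: (iter n f u) => {}v.
apply: connect_trans (fconnect1 g v) _; rewrite gE.
by case: tpermP => [->|->|//]; rewrite // sym.
Qed.

End Swap.

(** * A single non-Seifert splice *)

Section Splice.
Variable P : knot_projection.
Implicit Types (d x y z : dart P).
Local Notation co := (fconnect (@straight P)).
Local Notation region := (face (set0 : {set crossing P})).

(** When [node z] and [opp z] have the same orientation, the splice opens the
    passage between the opposite corners z and [opp z]: a boundary walk that
    would turn into one of these corners continues into the other instead, and
    every other turn is unchanged. *)
Lemma nonSeifert_at z d : co (node z) (opp z) -> d.1 = z.1 ->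
  nonSeifert d = tperm z (opp z) (node_inv d).
Proof.
move=> zz; have co_opp u v : co (opp u) (opp v) = co u v.
  by rewrite same_straight_opp straight_sym same_straight_opp straight_sym negbK.
have z_nz: co z (node z) = false.
  by rewrite straight_sym -[X in co _ X]oppK same_straight_opp zz.
have node_opp u : node (opp u) = opp (node u) by [].
have inv_opp u : node_inv (opp u) = node u by rewrite node_invE node_opp oppK.
have n1 := node_neq z; have n2 := node_neq_opp z.
case/same_crossing/or4P=> /eqP->; rewrite /nonSeifert.
- rewrite z_nz node_invE tpermD // eq_sym ?(inj_eq (can_inj (@oppK P))) //.
  by rewrite -[z]oppK (inj_eq (can_inj (@oppK P))) oppK.
- by rewrite zz nodeK tpermL.
- by rewrite node_opp co_opp z_nz inv_opp tpermD // eq_sym.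
by rewrite node_opp -[node (node z)]/(opp z) oppK -[z in co _ z]oppK co_opp zz
  inv_opp tpermR.
Qed.

Lemma nonSeifert_crossing d : (nonSeifert d).1 = d.1.
Proof. by rewrite /nonSeifert; case: ifP. Qed.

Lemma face1 z d : co (node z) (opp z) ->
  face [set z.1] d = tperm z (opp z) (region d).
Proof.
move=> zz; rewrite face0 /face inE; case: eqP => [/(nonSeifert_at zz) // | neq_z].
by rewrite tpermD //; apply: contra_not_neq neq_z => def_z;
  rewrite -[_.1]/(node_inv (edge d)).1 -def_z.
Qed.

Lemma nonSeifertK : involutive (@nonSeifert P).
Proof.
move=> d; rewrite {2}/nonSeifert; case: ifP => [dn | /negbT dn].
  rewrite /nonSeifert -[node (node d)]/(opp d) same_straight_opp straight_sym dn.
  exact: nodeK.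
have nd: co (node_inv d) d by rewrite node_invE straight_sym same_straight_opp.
by rewrite /nonSeifert node_invK nd.
Qed.

Lemma walk1_edge a d : walk [set a] (edge (walk [set a] d)) = edge d.
Proof.
rewrite /walk edgeK !inE; case d_a: ((edge d).1 == a).
  by rewrite nonSeifert_crossing d_a nonSeifertK.
by rewrite /= d_a oppK.
Qed.

Lemma walk1_inj a : injective (@walk P [set a]).
Proof.
move=> d x eq_dx; apply: (can_inj (@edgeK P)).
by rewrite -[LHS](walk1_edge a) -[RHS](walk1_edge a) eq_dx.
Qed.

(** Up to direction, the curve that leaves along [node z] after the splice
    follows P until P returns to the double point, where it meets the second
    pair of ends. As it passes through both pairs, it contains all of P. *)
Lemma single_curve1 z : co (node z) (opp z) -> single_curve [set z.1].
Proof.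
move=> zz; pose W := @walk P [set z.1].
have symW := fconnect_sym (@walk1_inj z.1).
pose L d := fconnect W (node z) d || fconnect W (node z) (edge d).
have L_edge d : L (edge d) = L d by rewrite /L edgeK orbC.
have L_walk d : L d -> L (W d).
  case/orP=> zd; apply/orP; [left | right]; apply: connect_trans zd _.
    exact: fconnect1.
  by rewrite symW -[X in fconnect W _ X](walk1_edge z.1) fconnect1.
have L_turn d : d.1 = z.1 -> L d -> L (nonSeifert d).
  move=> def_d; rewrite -L_edge => /L_walk.
  by rewrite /W /walk edgeK inE def_d eqxx.
have L_nz: L (node z) by rewrite /L connect0.
have L_oz: L (opp z).
  by have := L_turn (node z) (erefl _) L_nz; rewrite /nonSeifert zz.
have L_opp d : d.1 != z.1 -> L d -> L (opp d).
  rewrite -L_edge => neq_d /L_walk.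
  by rewrite /W /walk edgeK inE (negPf neq_d).
have turn_z: nonSeifert (opp (node z)) = z.
  rewrite (nonSeifert_at zz) // node_invE -[node _]/(opp (node (node z))).
  by rewrite oppK tpermR.
have same_opp u v : co u v -> co u (opp v) = false.
  by rewrite same_straight_opp => ->.
have L_z: L z.
  have L_onz: L (opp (node z)) -> L z.
    by move/L_turn => /(_ (erefl _)); rewrite turn_z.
  have before u : co (node z) u -> L u \/ L z.
    move/iter_findex <-; elim: (findex _ _ _) => [|n IHn] /=; first by left.
    have: co (node z) (straight (iter n (@straight P) (node z))).
      exact: (@fconnect_iter _ _ n.+1).
    case: IHn; last by right.
    rewrite -L_edge /straight; move: (edge _) => {}u Lu co_u.
    case: (eqVneq u.1 z.1) => [u_z | /L_opp]; last by left; auto.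
    case/or4P: (same_crossing u_z) (Lu) co_u => /eqP->; first by right.
    - by rewrite same_opp ?connect0.
    - by rewrite same_opp.
    by right; apply: L_onz.
  have [||//] := before (finv (@straight P) (node z)); first exact: fconnect_finv.
  rewrite -L_edge -[edge _]oppK -[opp (edge _)]/(straight _).
  by rewrite f_finv //; apply: straight_inj.
have L_onz: L (opp (node z)).
  by have := L_turn z (erefl _) L_z; rewrite -{1}turn_z nonSeifertK.
have L_straight d : L d -> L (straight d).
  rewrite -L_edge /straight; move: (edge d) => {}d Ld.
  case: (eqVneq d.1 z.1) => [d_z | /L_opp]; last by auto.
  by case/or4P: (same_crossing d_z) => /eqP->; rewrite ?oppK.
have L_co d : co (node z) d -> L d.
  by move/iter_findex <-; elim: (findex _ _ _) => //= n /L_straight.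
have L_all d : L d.
  case nzd: (co (node z) d); first exact: L_co.
  by rewrite -L_edge L_co // same_straight_edge nzd.
have W_edge u v : fconnect W u v -> fconnect W (edge u) (edge v).
  move/iter_findex <-; elim: (findex _ _ _) => [|n IHn] /=; first exact: connect0.
  apply: connect_trans IHn _; rewrite symW.
  by rewrite -[X in fconnect W _ X](walk1_edge z.1) fconnect1.
have W_nz u v :
    fconnect W (node z) u -> fconnect W (node z) v -> fconnect W u v.
  by rewrite symW; apply: connect_trans.
move=> d x; case/orP: (L_all d) => zd; case/orP: (L_all x) => zx;
  have := W_nz _ _ zd zx; auto.
  by move/W_edge; rewrite edgeK; right.
by move/W_edge; rewrite !edgeK; left.
Qed.

End Splice.

(** * Nugatory double points and curves through two double points *)

Section Nugatory.
Variable P : knot_projection.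
Implicit Types (d x y z : dart P) (S : {set crossing P}).
Local Notation co := (fconnect (@straight P)).
Local Notation region := (face (set0 : {set crossing P})).

Lemma nugatoryP S c :
  nugatory S c <->
  exists x, [/\ x.1 = c, c \notin S & fconnect (face S) x (opp x)].
Proof.
split=> [[C [[C_neq0 C_uniq C_S C_cycle _] C_c]] | [x [<- xS xx]]].
  have at_c x : x \in C -> x.1 = c.
    by move=> Cx; apply/set1P; rewrite -C_c; apply: imset_f.
  move: C_neq0 C_uniq C_S C_cycle at_c {C_c}.
  case: C => [|x [|y C]] // _ C_uniq C_S C_cycle at_c.
    exists x; split; first by rewrite at_c ?inE.
      by rewrite -(at_c x) ?C_S ?inE.
    by move: C_cycle; rewrite /= andbT.
  by rewrite /= inE (at_c x) ?(at_c y) ?inE ?eqxx ?orbT in C_uniq.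
exists [:: x]; split; last first.
  apply/setP=> v; apply/imsetP/set1P => [[u /[!inE] /eqP->] | ->] //.
  by exists x; rewrite ?inE.
split=> //=; first by move=> u /[!inE] /eqP->.
  by rewrite xx.
by move=> u v /[!inE] /eqP-> /eqP->; rewrite eqxx.
Qed.

Lemma reduced_corners : reduced P -> forall x, ~~ fconnect region x (opp x).
Proof.
move=> redP x; apply/negP => xx; apply: redP; split; first exact: kp_single.
by exists x.1; apply/nugatoryP; exists x; rewrite inE.
Qed.

Lemma reductivity1 : reduced P ->
  reductivity P 1 <-> exists a, reducible [set a : crossing P].
Proof.
move=> redP; split=> [[[S [redS /eqP/cards1P[a def_S]]] _] | [a red_a]].
  by exists a; rewrite -def_S.
split; first by exists [set a]; rewrite cards1.
move=> S redS; rewrite card_gt0; apply/eqP => S0; apply: redP.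
by rewrite /reduced -S0.
Qed.

(** Since no region of a reduced projection contains two opposite corners, the
    two arcs lie in distinct regions and cannot be linked. *)
Lemma two_point_curveP a b : reduced P -> a != b ->
  (exists2 C : seq (dart P), admissible set0 C & meets C = [set a; b]) <->
  exists x y, [/\ x.1 = a, y.1 = b, fconnect region x (opp y)
                & fconnect region y (opp x)].
Proof.
move=> redP neq_ab; have red := reduced_corners redP.
split=> [[C [C_neq0 C_uniq _ C_cycle _] C_ab] | [x [y [x_a y_b xy yx]]]].
  have: perm_eq [seq x.1 | x <- C] [:: a; b].
    apply: uniq_perm; rewrite //= ?inE ?neq_ab // => c.
    have /setP/(_ c) := C_ab; rewrite !inE => <-.
    by apply/mapP/imsetP => -[x Cx ->]; exists x.
  move: C_neq0 C_uniq C_cycle {C_ab}.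
  case: C => [|x [|y [|z C]]] // _ C_uniq C_cycle; try by move/perm_size.
  move=> /= /perm_mem xy_ab; move: C_cycle => /= /and3P[xy yx _].
  have := xy_ab x.1; have := xy_ab y.1; rewrite !inE !eqxx orbT /=.
  rewrite /= inE andbT in C_uniq.
  case/esym/orP => /eqP y_; case/esym/orP => /eqP x_.
  - by rewrite x_ y_ eqxx in C_uniq.
  - by exists y, x.
  - by exists x, y.
  - by rewrite x_ y_ eqxx in C_uniq.
have sym := fconnect_sym (@region_inj P).
have apart_xy : ~~ fconnect region x y.
  apply: contra (red x) => xxy; apply: connect_trans xxy yx.
exists [:: x; y]; last first.
  apply/setP => c; rewrite !inE -x_a -y_b.
  apply/imsetP/orP => [[u /[!inE] /orP[] /eqP-> ->] | [] /eqP->].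
  - by left.
  - by right.
  - by exists x; rewrite ?inE ?eqxx.
  - by exists y; rewrite ?inE ?eqxx ?orbT.
split=> //=.
- by rewrite inE x_a y_b neq_ab.
- by move=> u; rewrite !inE.
- by rewrite xy yx.
move=> u v; rewrite !inE => /orP[] /eqP-> /orP[] /eqP->; rewrite ?eqxx // => _ uv.
  by rewrite uv in apart_xy.
by rewrite sym uv in apart_xy.
Qed.

(** The splice merges the regions of x and [opp x] and leaves the others alone.
    Two opposite corners at y, which were in distinct regions, are in the same
    one afterwards exactly when they were in these two, in either order. *)
Lemma nugatory_after_splice x y : reduced P -> co (node x) (opp x) ->
  fconnect (face [set x.1]) y (opp y) <->
  (fconnect region x (opp y) /\ fconnect region y (opp x)) \/
  (fconnect region x y /\ fconnect region (opp y) (opp x)).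
Proof.
move=> redP xx; have red := reduced_corners redP.
have sym := fconnect_sym (@region_inj P).
have gE u := face1 u xx.
have symg := fconnect_sym (swap_inj (@region_inj P) gE).
have gxx := swap_merges (@region_inj P) gE (red x).
have region_face u v := @swap_coarser _ _ _ _ _ (@region_inj P) gE u v gxx.
split=> [/(fconnect_swap (@region_inj P) gE)[yy | [y_ oy_]] | ].
- by rewrite (negPf (red y)) in yy.
- have join u : fconnect region y u -> fconnect region (opp y) u -> False.
    move=> yu oyu; case/negP: (red y); apply: connect_trans yu _.
    by rewrite sym.
  case: y_ oy_ => y_ [] oy_.
  + by case: (join x).
  + by right; rewrite sym.
  + by left; rewrite [fconnect _ x _]sym.
  + by case: (join (opp x)).
case=> -[/region_face xy /region_face yx]; last rewrite symg;
  by apply: connect_trans yx (connect_trans _ xy); rewrite symg.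
Qed.

End Nugatory.

Theorem theorem3 (P : knot_projection) (hP : reduced P) :
  (exists (C : seq (dart P)) (a b : crossing P),
     [/\ a != b,
         admissible (set0 : {set crossing P}) C,
         meets C = [set a; b] &
         interleaved a b])
  <-> reductivity P 1.
Proof.
apply: (iff_trans _ (iff_sym (reductivity1 hP))); split.
  case=> [C [a [b [neq_ab C_adm C_ab ab]]]].
  have [x [y [x_a y_b xy yx]]] : exists x y : dart P,
      [/\ x.1 = a, y.1 = b, fconnect (face set0) x (opp y)
         & fconnect (face set0) y (opp x)].
    by apply/(two_point_curveP hP neq_ab); exists C.
  rewrite -{}x_a -{}y_b in neq_ab ab.
  have [side [side_str side_x]] := jordan_side xy yx neq_ab.
  have /(interleavedP neq_ab side_str side_x) xx := ab.
  exists x.1; split; first exact: single_curve1.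
  exists y.1; apply/nugatoryP; exists y; rewrite inE eq_sym; split=> //.
  by apply/(nugatory_after_splice y hP xx); left.
case=> a [_ [b /nugatoryP[y [y_b neq_ba yy]]]].
rewrite inE eq_sym in neq_ba.
(* the corners opened by the splice at a *)
have [x x_a xx] : exists2 x : dart P, x.1 = a
    & fconnect (@straight P) (node x) (opp x).
  have [nn | nn] := boolP (fconnect (@straight P) (a, ord0) (node (a, ord0))).
    exists (node_inv (a, ord0)) => //.
    by rewrite /opp node_invK.
  exists (a, ord0) => //.
  by rewrite same_straight_opp straight_sym.
rewrite -x_a -y_b in yy neq_ba *.
have [z z_a [xy yx]] : exists2 z : dart P, z.1 = y.1 &
    fconnect (face set0) x (opp z) /\ fconnect (face set0) z (opp x).
  have [|[xy yx]] := (nugatory_after_splice y hP xx).1 yy; first by exists y.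
  by exists (opp y); rewrite ?oppK.
rewrite -z_a in neq_ba.
have [C C_adm C_ab] := (two_point_curveP hP neq_ba).2
  (ex_intro _ x (ex_intro _ z (And4 (erefl _) (erefl _) xy yx))).
exists C, x.1, z.1; split=> //.
have [side [side_str side_x]] := jordan_side xy yx neq_ba.
exact/(interleavedP neq_ba side_str side_x).
Qed.
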